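(* The finite bivariate M-Konhauser polynomials ${}_{K}M_{k;\upsilon}^{(p,q)}(y,z)$ (with $p>2\max\{k\}+1$, $q>-1$, $\upsilon=1,2,\dots$) have the following generating function: $$\sum_{k=0}^{\infty}\frac{(-1)^k(1-p)_k}{(q+1)_k}\;{}_{K}M_{k;\upsilon}^{(p,q)}(y,z)\,\frac{w^k}{k!}=\frac{1}{\Gamma(1-p-q)(1-w)^{1-p}}\;S^{1:0;0}_{0:0;0}\left[\begin{matrix}[1-p:2,1]:-;-;\\ -:[q+1:1];[1-p-q:\upsilon];\end{matrix}\;\frac{wy}{(w-1)^2},\frac{wz^{\upsilon}}{w-1}\right].$$
   Context: $(a)_n=a(a+1)\cdots(a+n-1)$, $(a)_0=1$. For $p>2\max\{k\}+1$, $q>-1$ and $\upsilon=1,2,\dots$, the finite bivariate M-Konhauser polynomials are $${}_{K}M_{k;\upsilon}^{(p,q)}(y,z)=(-1)^k\Gamma(k+q+1)\sum_{l=0}^{k}\sum_{s=0}^{k-l}\frac{(-k)_{l+s}(k+1-p)_l(-y)^l z^{\upsilon s}}{\Gamma(l+q+1)\Gamma(\upsilon s-p-q+1)\,l!\,s!}.$$ $S$ denotes the (Srivastava–Daoust) double hypergeometric series; in the present case $$S^{1:0;0}_{0:0;0}\left[\begin{matrix}[1-p:2,1]:-;-;\\ -:[q+1:1];[1-p-q:\upsilon];\end{matrix}\;X,Z\right]=\sum_{l=0}^{\infty}\sum_{s=0}^{\infty}\frac{(1-p)_{2l+s}}{(q+1)_l\,(1-p-q)_{\upsilon s}}\,\frac{X^l}{l!}\,\frac{Z^s}{s!}.$$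 *)

(* Defs.v *)
From Stdlib Require Import Reals Factorial.
From Coquelicot Require Import Coquelicot.
Open Scope R_scope.

Fixpoint poch (a : R) (n : nat) : R :=
  match n with
  | O => 1
  | S m => poch a m * (a + INR m)
  end.

(* Gamma function on R minus {0, -1, -2, ...}, by the Euler-Gauss product
     Gamma(x) = lim_n  n! n^x / (x (x+1) ... (x+n)).
   This covers the negative non-integer arguments directly; the value at the
   poles 0, -1, -2, ... is meaningless. *)
Definition Gamma (x : R) : R :=
  real (Lim_seq (fun n => INR (fact n) * Rpower (INR n) x / poch x (S n))).

(* Principal argument, by the half-angle formula; correct off the closed
   negative real axis. *)
Definition Carg (c : C) : R := 2 * atan (Im c / (Cmod c + Re c)).

(* Principal value of c^a = exp (a Log c), for real a and c off the closed
   negative real axis. *)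
Definition Cpower (c : C) (a : R) : C :=
  (RtoC (Rpower (Cmod c) a) * (cos (a * Carg c), sin (a * Carg c)))%C.

Definition CSeries (u : nat -> C) : C :=
  (Series (fun n => Re (u n)), Series (fun n => Im (u n))).

Definition abs_summable2 (u : nat -> nat -> C) : Prop :=
  (forall l, ex_series (fun s => Cmod (u l s))) /\
  ex_series (fun l => Series (fun s => Cmod (u l s))).

(* The finite bivariate M-Konhauser polynomial of index k with Konhauser
   parameter v.  The bounds of [sum_n] are inclusive.  The explicit formula is
   used for every k, whether or not p > 2 k + 1. *)
Definition MKonhauser (p q : R) (k v : nat) (y z : C) : C :=
  (RtoC ((-1) ^ k * Gamma (INR k + q + 1)) *
   sum_n (fun l : nat =>
     sum_n (fun s : nat =>
       RtoC (poch (- INR k) (l + s) * poch (INR k + 1 - p) l) *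
       (- y) ^ l * z ^ (v * s) /
       RtoC (Gamma (INR l + q + 1) * Gamma (INR (v * s) - p - q + 1) *
             INR (fact l) * INR (fact s)))
       (k - l))
     k)%C.

(* General term of the Srivastava-Daoust double series
   S^{1:0;0}_{0:0;0} [ [a : 2,1] : - ; - ; - : [b : 1] ; [c : v] ; X, Z ]. *)
Definition SD_term (a b c : R) (v : nat) (X Z : C) (l s : nat) : C :=
  (RtoC (poch a (2 * l + s) / (poch b l * poch c (v * s))) *
   (X ^ l / RtoC (INR (fact l))) * (Z ^ s / RtoC (INR (fact s))))%C.

Definition SD (a b c : R) (v : nat) (X Z : C) : C :=
  CSeries (fun l => CSeries (fun s => SD_term a b c v X Z l s)).

(* Main.v *)
Require Import Defs.
From Stdlib Require Import Reals Factorial Lra Lia.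
From Coquelicot Require Import Coquelicot.
Open Scope R_scope.

(** Write [a = 1 - p], [b = q + 1], [c = 1 - p - q].  The identity is a
    rearrangement of one absolutely convergent triple series.

    Since [Gamma (x + n) = (x)_n Gamma x], [(a)_k (a + k)_l = (a)_(k + l)] and
    [(-k)_n = (-1)^n k! / (k - n)!], the [k]-th term of the generating series is
    [1 / Gamma c] times the sum, over all [l + s + m = k], of
    [(a)_(2l+s) (wy)^l (- w z^v)^s / ((b)_l (c)_(vs) l! s!)
       * (a + 2l + s)_m w^m / m!]
    ([Konhauser_generating_term]).  Grouping the terms by [k] or summing over
    [m], [s] and [l] one after the other gives the same value
    ([is_Cseries_simplex]).  The sum over [m] is the binomial series of
    [(1 - w)^-(a + 2l + s)] ([is_Cseries_binomial]); the power [2l + s] of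
    [1 / (1 - w)] turns [wy] and [- w z^v] into the arguments
    [wy / (w - 1)^2] and [w z^v / (w - 1)] of the double series, and
    [(1 - w)^-a] is the prefactor.

    Absolute convergence is where the hypothesis on [wy] enters.  Replacing
    [a] by [A = |a|], which is positive as [p > 1], and all variables by their
    moduli, the sum over [m] is again binomial and leaves a double series with
    arguments [X = |wy| / (1 - |w|)^2 < 1/4] and [Z = |w z^v| / (1 - |w|)].  The factor
    [1 / (c)_(vs)] decays faster than any geometric sequence, so, up to a
    constant factor, [Z] may be replaced by an arbitrarily small [eta]; the sum
    over [s] is then binomial once more, and the ratio test applies to the sum
    over [l], where the ratios of [(A)_(2l) / ((b)_l l!)] tend to [4] ([SD_majorant_summable]).

    The functional equation of [Gamma] has to be read off from the Gauss
    product, which requires that the product converges ([Gamma_is_lim]), and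
    the binomial series has to be matched with the power function given by
    the half-angle argument; this is done through the differential equation
    that both satisfy along the segment from [0] to [w]. *)

(** * Shifted factorials *)

Lemma poch_add (a : R) (m n : nat) :
  poch a (m + n) = poch a m * poch (a + INR m) n.
Proof.
  induction n as [|n IH].
  - rewrite Nat.add_0_r. simpl. ring.
  - rewrite Nat.add_succ_r. simpl. rewrite IH, plus_INR. ring.
Qed.

Lemma poch_pos (a : R) (n : nat) : 0 < a -> 0 < poch a n.
Proof.
  intros ha. induction n as [|n IH]; simpl; [lra|].
  apply Rmult_lt_0_compat; [exact IH|]. pose proof (pos_INR n). lra.
Qed.

Lemma poch_neq_0 (a : R) (n : nat) :
  (forall m : nat, a <> - INR m) -> poch a n <> 0.
Proof.
  intros ha. induction n as [|n IH]; simpl; [lra|].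
  apply Rmult_integral_contrapositive_currified; [exact IH|].
  specialize (ha n). lra.
Qed.

Lemma poch_abs_le (a : R) (n : nat) : Rabs (poch a n) <= poch (Rabs a) n.
Proof.
  induction n as [|n IH]; simpl.
  - rewrite Rabs_R1. lra.
  - rewrite Rabs_mult. apply Rmult_le_compat; try apply Rabs_pos; [exact IH|].
    eapply Rle_trans; [apply Rabs_triang|].
    rewrite (Rabs_pos_eq (INR n)) by apply pos_INR. lra.
Qed.

Lemma poch_opp_INR (k n : nat) : (n <= k)%nat ->
  poch (- INR k) n * INR (fact (k - n)) = (-1) ^ n * INR (fact k).
Proof.
  induction n as [|n IH]; intros hn.
  - simpl. rewrite Nat.sub_0_r. ring.
  - rewrite <- tech_pow_Rmult, Rmult_assoc, <- IH by lia.
    replace (k - n)%nat with (S (k - S n)) by lia.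
    rewrite fact_simpl, mult_INR.
    replace (INR (S (k - S n))) with (INR k - INR n)
      by (rewrite <- minus_INR by lia; f_equal; lia).
    simpl. ring.
Qed.

Lemma poch_le (a b : R) (n : nat) : 0 <= a <= b -> 0 <= poch a n <= poch b n.
Proof.
  intros hab. induction n as [|n IH]; simpl; [lra|].
  pose proof (pos_INR n). split.
  - apply Rmult_le_pos; lra.
  - apply Rmult_le_compat; lra.
Qed.

(** * The Gauss product for the Gamma function *)

Definition Gamma_seq (x : R) (n : nat) : R :=
  INR (fact n) * Rpower (INR n) x / poch x (S n).

Lemma ln_sub_le (s t : R) : 0 < s -> 0 < t -> ln t - ln s <= t / s - 1.
Proof.
  intros hs ht. rewrite <- ln_div by assumption.
  assert (h : 0 < t / s) by (apply Rdiv_lt_0_compat; assumption).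
  pose proof (exp_ineq1_le (ln (t / s))) as he. rewrite exp_ln in he by exact h. lra.
Qed.

(** Both terms on the right are [x / n + O(1 / n^2)], so the increments of
    [ln Gamma_seq] are summable.  The index starts at [1] because [ln 0] is
    meaningless. *)
Lemma ln_Gamma_seq_S (x : R) (n : nat) : 0 < x ->
  ln (Gamma_seq x (S (S n))) - ln (Gamma_seq x (S n)) =
  x * (ln (INR (S (S n))) - ln (INR (S n)))
  - (ln (x + INR (S (S n))) - ln (INR (S (S n)))).
Proof.
  intros hx.
  assert (h1 : 0 < INR (S n)) by (apply lt_0_INR; lia).
  assert (h2 : 0 < INR (S (S n))) by (apply lt_0_INR; lia).
  unfold Gamma_seq.
  change (poch x (S (S (S n)))) with (poch x (S (S n)) * (x + INR (S (S n)))).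
  rewrite (fact_simpl (S n)), mult_INR.
  assert (hf : 0 < INR (fact (S n))) by (apply lt_0_INR, lt_O_fact).
  assert (hP : 0 < poch x (S (S n))) by (apply poch_pos; exact hx).
  assert (hR : forall a b, 0 < Rpower a b) by (intros; apply exp_pos).
  assert (hq : 0 < x + INR (S (S n))) by lra.
  assert (hF : 0 < INR (S (S n)) * INR (fact (S n))) by (apply Rmult_lt_0_compat; assumption).
  rewrite (ln_div (INR (S (S n)) * _ * _)) by (apply Rmult_lt_0_compat; auto).
  rewrite (ln_div (INR (fact _) * _)) by (first [exact hP | apply Rmult_lt_0_compat; auto]).
  rewrite !ln_mult by auto.
  unfold Rpower. rewrite !ln_exp. ring.
Qed.

(** For [x > 0] the sequence [ln Gamma_seq] increases, and it stays bounded
    because its increments are dominated by a telescoping sum.  Working with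
    the logarithm gives a nonzero limit at once. *)
Lemma Gamma_seq_cv_pos (x : R) : 0 < x ->
  exists L : R, L <> 0 /\ is_lim_seq (Gamma_seq x) L.
Proof.
  intros hx.
  set (h := fun n => ln (Gamma_seq x (S n))).
  assert (hstep : forall n, h n <= h (S n) <=
     h n + x * (x + 1) * (1 / INR (S n) - 1 / INR (S (S n)))).
  { intros n. pose proof (ln_Gamma_seq_S x n hx) as e. unfold h.
    assert (h1 : 0 < INR (S n)) by (apply lt_0_INR; lia).
    rewrite (S_INR (S n)) in *. set (N := INR (S n)) in *.
    pose proof (ln_sub_le N (N + 1) ltac:(lra) ltac:(lra)) as b1.
    pose proof (ln_sub_le (N + 1) N ltac:(lra) ltac:(lra)) as b2.
    pose proof (ln_sub_le (N + 1) (x + (N + 1)) ltac:(lra) ltac:(lra)) as b3.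
    pose proof (ln_sub_le (x + (N + 1)) (N + 1) ltac:(lra) ltac:(lra)) as b4.
    apply (Rmult_le_compat_l x) in b1; [|lra].
    apply (Rmult_le_compat_l x) in b2; [|lra].
    split.
    - assert (x * (N / (N + 1) - 1) + ((x + (N + 1)) / (N + 1) - 1) = 0)
        by (field; lra). lra.
    - assert (x * ((N + 1) / N - 1) + ((N + 1) / (x + (N + 1)) - 1)
        <= x * (x + 1) * (1 / N - 1 / (N + 1))); [|lra].
      apply Rminus_le_0.
      replace (_ - _) with (x * (x + 1) * x / (N * (N + 1) * (x + (N + 1))))
        by (field; lra).
      apply Rdiv_le_0_compat; repeat apply Rmult_lt_0_compat; try lra.
      repeat apply Rmult_le_pos; lra. }
  destruct (ex_finite_lim_seq_incr h (h O + x * (x + 1))) as [L hL].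
  - intros n; apply hstep.
  - assert (forall n, h n <= h O + x * (x + 1) * (1 - 1 / INR (S n))).
    { induction n as [|n IH]; [simpl; lra|]. destruct (hstep n) as [_ hs]. lra. }
    intros n. eapply Rle_trans; [apply H|].
    assert (0 < 1 / INR (S n)) by (apply Rdiv_lt_0_compat; [lra|apply lt_0_INR; lia]).
    assert (0 < x * (x + 1)) by (apply Rmult_lt_0_compat; lra). nra.
  - exists (exp L). split; [apply Rgt_not_eq, exp_pos|].
    apply is_lim_seq_incr_1.
    apply is_lim_seq_ext with (fun n => exp (h n)).
    + intros n. unfold h. apply exp_ln. unfold Gamma_seq.
      apply Rdiv_lt_0_compat; [|apply poch_pos, hx].
      apply Rmult_lt_0_compat; [apply lt_0_INR, lt_O_fact|apply exp_pos].
    + apply (is_lim_seq_continuous exp h L); [|exact hL].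
      apply derivable_continuous_pt, derivable_pt_exp.
Qed.

(** The quotient [Gamma_seq (x + 1) n / Gamma_seq x n] is [x n / (x + n + 1)].
    So convergence passes from [x + 1] to [x], which reaches the negative
    arguments, and the limits satisfy the functional equation. *)
Lemma Gamma_seq_shift (x L : R) : (forall n : nat, x <> - INR n) ->
  is_lim_seq (Gamma_seq (x + 1)) L -> is_lim_seq (Gamma_seq x) (L / x).
Proof.
  intros hx hL.
  assert (hx0 : x <> 0) by (specialize (hx O); simpl in hx; lra).
  apply is_lim_seq_incr_1.
  apply is_lim_seq_ext with
    (fun n => Gamma_seq (x + 1) (S n) * ((1 + (x + 1) * / INR (S n)) * / x)).
  - intros n. unfold Gamma_seq.
    assert (h1 : 0 < INR (S n)) by (apply lt_0_INR; lia).
    rewrite Rpower_plus, Rpower_1 by exact h1.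
    change (poch (x + 1) (S (S n))) with (poch (x + 1) (S n) * (x + 1 + INR (S n))).
    replace (poch x (S (S n))) with (x * poch (x + 1) (S n))
      by (change (S (S n)) with (1 + S n)%nat; rewrite poch_add; cbn [poch INR]; ring).
    pose proof (hx (S (S n))) as h2. rewrite S_INR in h2.
    assert (h3 : poch (x + 1) (S n) <> 0).
    { apply poch_neq_0. intros m. pose proof (hx (S m)) as h. rewrite S_INR in h. lra. }
    field. repeat split; lra.
  - unfold Rdiv. apply is_lim_seq_mult'; [apply (is_lim_seq_incr_1 (Gamma_seq (x + 1))), hL|].
    replace (Finite (/ x)) with (Finite ((1 + (x + 1) * 0) * / x)) by (f_equal; field; exact hx0).
    apply is_lim_seq_mult'; [|apply is_lim_seq_const].
    apply is_lim_seq_plus'; [apply is_lim_seq_const|].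
    apply is_lim_seq_mult'; [apply is_lim_seq_const|].
    apply (is_lim_seq_incr_1 (fun n => / INR n)).
    apply (is_lim_seq_inv INR p_infty); [apply is_lim_seq_INR|discriminate].
Qed.

Lemma Gamma_seq_cv (x : R) : (forall n : nat, x <> - INR n) ->
  exists L : R, L <> 0 /\ is_lim_seq (Gamma_seq x) L.
Proof.
  intros hx.
  destruct (nfloor_ex (Rabs x) (Rabs_pos x)) as [m [_ hm]].
  assert (hxm : 0 < x + INR (S m)).
  { rewrite S_INR. pose proof (Rle_abs (- x)) as h. rewrite Rabs_Ropp in h. lra. }
  clear hm. revert x hx hxm. generalize (S m). clear m.
  induction n as [|n IH]; intros x hx hxn.
  - apply Gamma_seq_cv_pos. simpl in hxn. lra.
  - destruct (IH (x + 1)) as [L [hL hlim]].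
    + intros m. pose proof (hx (S m)) as h. rewrite S_INR in h. lra.
    + rewrite S_INR in hxn. lra.
    + exists (L / x). split; [|apply Gamma_seq_shift; assumption].
      apply Rmult_integral_contrapositive_currified; [exact hL|].
      apply Rinv_neq_0_compat. specialize (hx O). simpl in hx. lra.
Qed.

(** As [Gamma] is a total function, its value only means something once the
    limit is known to exist and to be finite. *)
Lemma Gamma_is_lim (x : R) : (forall n : nat, x <> - INR n) ->
  Gamma x <> 0 /\ is_lim_seq (Gamma_seq x) (Gamma x).
Proof.
  intros hx. destruct (Gamma_seq_cv x hx) as [L [hL hlim]].
  assert (e : Gamma x = L) by
    (unfold Gamma; fold (Gamma_seq x); rewrite (is_lim_seq_unique _ _ hlim); reflexivity).
  rewrite e. split; assumption.
Qed.

Lemma Gamma_add_INR (x : R) (n : nat) : (forall m : nat, x <> - INR m) ->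
  Gamma (x + INR n) = poch x n * Gamma x.
Proof.
  intros hx. induction n as [|n IH].
  - simpl. rewrite Rplus_0_r. ring.
  - assert (hxn : forall m : nat, x + INR n <> - INR m).
    { intros m. pose proof (hx (m + n)%nat) as h. rewrite plus_INR in h. lra. }
    assert (hxS : forall m : nat, x + INR n + 1 <> - INR m).
    { intros m. pose proof (hxn (S m)) as h. rewrite S_INR in h. lra. }
    rewrite S_INR, <- Rplus_assoc.
    destruct (Gamma_is_lim _ hxS) as [_ h1].
    apply (Gamma_seq_shift _ _ hxn), is_lim_seq_unique in h1.
    destruct (Gamma_is_lim _ hxn) as [_ h2].
    apply is_lim_seq_unique in h2. rewrite h1 in h2.
    injection h2 as h2. specialize (hxn O). simpl in hxn. simpl.
    replace (Gamma (x + INR n + 1)) with ((x + INR n) * Gamma (x + INR n))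
      by (rewrite <- h2; field; lra).
    rewrite IH. ring.
Qed.

(** * Complex series and rearrangement *)

Notation is_Cseries := (is_series (K := C_AbsRing) (V := C_NormedModule)) (only parsing).

Lemma RtoC_neq_0 (x : R) : x <> 0 -> RtoC x <> 0.
Proof. intros hx h. apply hx, RtoC_inj, h. Qed.

Lemma sum_n_C (u : nat -> C) (n : nat) :
  sum_n (G := C_NormedModule) u n =
  (sum_n (fun k => Re (u k)) n, sum_n (fun k => Im (u k)) n).
Proof.
  induction n as [|n IH].
  - rewrite !sum_O. apply surjective_pairing.
  - rewrite !sum_Sn, IH. reflexivity.
Qed.

Lemma sum_n_Cmult_l (c : C) (u : nat -> C) (n : nat) :
  (c * sum_n (G := C_NormedModule) u n)%C =
  sum_n (G := C_NormedModule) (fun k => (c * u k)%C) n.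
Proof.
  exact (eq_sym (sum_n_mult_l (K := C_Ring) c u n)).
Qed.

Lemma is_Cseries_components (u : nat -> C) (l : C) :
  is_Cseries u l <->
  is_series (fun n => Re (u n)) (Re l) /\ is_series (fun n => Im (u n)) (Im l).
Proof.
  assert (e : forall n, sum_n (G := C_NormedModule) u n =
    (sum_n (fun k => Re (u k)) n, sum_n (fun k => Im (u k)) n))
    by (intros n; apply sum_n_C).
  unfold is_series. split.
  - intros h. split; intros P [eps hP].
    + destruct (h (fun c : C => P (Re c))) as [N hN].
      { exists eps. intros c [hc _]. apply hP, hc. }
      exists N. intros n hn. specialize (hN n hn). rewrite e in hN. exact hN.
    + destruct (h (fun c : C => P (Im c))) as [N hN].
      { exists eps. intros c [_ hc]. apply hP, hc. }
      exists N. intros n hn. specialize (hN n hn). rewrite e in hN. exact hN.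
  - intros [hr hi] P [eps hP].
    destruct (hr _ (locally_ball (Re l) eps)) as [N1 h1].
    destruct (hi _ (locally_ball (Im l) eps)) as [N2 h2].
    exists (max N1 N2). intros n hn. rewrite e. apply hP.
    split; [apply h1 | apply h2]; lia.
Qed.

Lemma CSeries_unique (u : nat -> C) (l : C) : is_Cseries u l -> CSeries u = l.
Proof.
  intros h. apply is_Cseries_components in h. destruct h as [hr hi].
  unfold CSeries. apply is_series_unique in hr, hi. rewrite hr, hi.
  symmetry. apply surjective_pairing.
Qed.

Lemma Im_le_Cmod (c : C) : Rabs (Im c) <= Cmod c.
Proof.
  eapply Rle_trans; [apply Rmax_r|]. apply Rmax_Cmod.
Qed.

Lemma CSeries_correct (u : nat -> C) :
  ex_series (fun n => Cmod (u n)) -> is_Cseries u (CSeries u).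
Proof.
  intros h. apply is_Cseries_components. split; apply Series_correct;
    apply (ex_series_le (K := R_AbsRing) (V := R_CompleteNormedModule))
      with (2 := h); intros n.
  - apply re_le_Cmod.
  - apply Im_le_Cmod.
Qed.

Lemma CSeries_ext (u v : nat -> C) :
  (forall n, u n = v n) -> CSeries u = CSeries v.
Proof.
  intros h. unfold CSeries. f_equal; apply Series_ext; intros n; now rewrite h.
Qed.

Lemma CSeries_scal_l (c : C) (u : nat -> C) :
  ex_series (fun n => Cmod (u n)) ->
  CSeries (fun n => (c * u n)%C) = (c * CSeries u)%C.
Proof.
  intros h. apply CSeries_unique.
  exact (is_series_scal (K := C_AbsRing) (V := C_NormedModule) c u _ (CSeries_correct u h)).
Qed.

Lemma sum_n_nonneg (f : nat -> R) (n : nat) :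
  (forall k, 0 <= f k) -> 0 <= sum_n f n.
Proof.
  intros h. induction n as [|n IH]; [rewrite sum_O; apply h|].
  rewrite sum_Sn. apply Rplus_le_le_0_compat; [exact IH|apply h].
Qed.

Lemma sum_n_le_Series (f : nat -> R) (n : nat) :
  (forall k, 0 <= f k) -> ex_series f -> sum_n f n <= Series f.
Proof.
  intros h hf. apply (is_lim_seq_incr_compare (sum_n f)).
  - apply Series_correct, hf.
  - intros k. rewrite sum_Sn. unfold plus; simpl. specialize (h (S k)). lra.
Qed.

Lemma ex_series_nonneg_le (f g : nat -> R) :
  (forall n, 0 <= f n <= g n) -> ex_series g -> ex_series f.
Proof.
  intros h. apply (ex_series_le (K := R_AbsRing) (V := R_CompleteNormedModule)).
  intros n. unfold norm; simpl. unfold abs; simpl. rewrite Rabs_pos_eq; apply h.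
Qed.

Lemma Series_nonneg (f : nat -> R) :
  (forall n, 0 <= f n) -> ex_series f -> 0 <= Series f.
Proof.
  intros h hf. eapply Rle_trans; [|apply (sum_n_le_Series f O h hf)].
  rewrite sum_O. apply h.
Qed.

Lemma sum_n_le_compat (f g : nat -> R) (n : nat) :
  (forall k, (k <= n)%nat -> f k <= g k) -> sum_n f n <= sum_n g n.
Proof.
  induction n as [|n IH]; intros h.
  - rewrite !sum_O. apply h; lia.
  - rewrite !sum_Sn. apply Rplus_le_compat; [apply IH|apply h]; auto with arith.
Qed.

Lemma sum_n_mono (f : nat -> R) (m n : nat) :
  (forall k, 0 <= f k) -> (m <= n)%nat -> sum_n f m <= sum_n f n.
Proof.
  intros h hmn. induction hmn as [|n _ IH]; [lra|].
  rewrite sum_Sn. unfold plus; simpl. specialize (h (S n)). lra.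
Qed.

(** Both sides run over the triangle [l + s <= n]. *)
Lemma sum_n_diag (u : nat -> nat -> R) (n : nat) :
  sum_n (fun k => sum_n (fun l => u l (k - l)%nat) k) n =
  sum_n (fun l => sum_n (u l) (n - l)) n.
Proof.
  induction n as [|n IH]; [rewrite !sum_O; reflexivity|].
  rewrite sum_Sn, IH, !sum_Sn, Nat.sub_diag, sum_O, plus_assoc. f_equal.
  rewrite <- sum_n_plus. apply sum_n_ext_loc. intros l hl.
  replace (S n - l)%nat with (S (n - l)) by lia. now rewrite sum_Sn.
Qed.

Lemma Cmod_CSeries_le (u : nat -> C) :
  ex_series (fun n => Cmod (u n)) ->
  Cmod (CSeries u) <= Series (fun n => Cmod (u n)).
Proof.
  intros h.
  apply (filterlim_le (F := eventually)
    (fun n => Cmod (sum_n (G := C_NormedModule) u n)) (sum_n (fun n => Cmod (u n)))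
    (Finite _) (Finite _)).
  - apply filter_forall. intros n.
    exact (norm_sum_n_m (K := C_AbsRing) (V := C_NormedModule) u 0 n).
  - apply (filterlim_comp _ _ _ _ (norm (K := C_AbsRing) (V := C_NormedModule)) _ _ _
      (CSeries_correct u h)).
    apply (filterlim_norm (K := C_AbsRing) (V := C_NormedModule)).
  - apply Series_correct, h.
Qed.

Lemma is_lim_seq_sum_n (f : nat -> nat -> R) (g : nat -> R) (n : nat) :
  (forall l, is_lim_seq (f l) (g l)) ->
  is_lim_seq (fun j => sum_n (fun l => f l j) n) (sum_n g n).
Proof.
  intros h. induction n as [|n IH].
  - rewrite sum_O. apply is_lim_seq_ext with (f O); [|apply h].
    intros j. now rewrite sum_O.
  - rewrite sum_Sn.
    apply is_lim_seq_ext with (fun j => sum_n (fun l => f l j) n + f (S n) j).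
    + intros j. now rewrite sum_Sn.
    + apply is_lim_seq_plus'; [exact IH|apply h].
Qed.

(** For nonnegative terms the sums over triangles [l + s <= n] increase; they
    lie below the iterated sum and, for large [n], above every rectangle, and
    the rectangles exhaust the iterated sum. *)
Lemma is_series_diag_nonneg (u : nat -> nat -> R) :
  (forall l s, 0 <= u l s) -> (forall l, ex_series (u l)) ->
  ex_series (fun l => Series (u l)) ->
  is_series (fun n => sum_n (fun l => u l (n - l)%nat) n)
    (Series (fun l => Series (u l))).
Proof.
  intros h0 h1 h2.
  set (D := sum_n (fun n => sum_n (fun l => u l (n - l)%nat) n)).
  assert (hS0 : forall l, 0 <= Series (u l)).
  { intros l. eapply Rle_trans; [|apply (sum_n_le_Series _ O); auto].
    rewrite sum_O. apply h0. }
  assert (hD : forall n, D n <= D (S n)).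
  { intros n. unfold D. apply sum_n_mono; [|lia]. intros k. apply sum_n_nonneg; auto. }
  assert (hub : forall n, D n <= Series (fun l => Series (u l))).
  { intros n. unfold D. rewrite sum_n_diag.
    eapply Rle_trans; [|apply (sum_n_le_Series _ n); auto].
    apply sum_n_le_compat. intros l _. apply sum_n_le_Series; auto. }
  destruct (ex_finite_lim_seq_incr D _ hD hub) as [L hL].
  assert (hlow : forall m, sum_n (fun l => Series (u l)) m <= L).
  { intros m.
    apply (is_lim_seq_le (fun j => sum_n (fun l => sum_n (u l) j) m) (fun _ => L)
      (sum_n (fun l => Series (u l)) m) L); [|apply is_lim_seq_sum_n|apply is_lim_seq_const].
    - intros j.
      apply Rle_trans with (D (m + j)%nat); [|apply is_lim_seq_incr_compare; assumption].
      unfold D. rewrite sum_n_diag.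
      eapply Rle_trans; [|apply (sum_n_mono _ m); [intros; apply sum_n_nonneg; auto|lia]].
      apply sum_n_le_compat. intros l hl. apply sum_n_mono; [auto|lia].
    - intros l. apply Series_correct, h1. }
  assert (e : L = Series (fun l => Series (u l))).
  { apply Rle_antisym.
    - apply (is_lim_seq_le D (fun _ => Series (fun l => Series (u l))) L
        (Series (fun l => Series (u l)))); auto. apply is_lim_seq_const.
    - apply (is_lim_seq_le (sum_n (fun l => Series (u l))) (fun _ => L)
        (Series (fun l => Series (u l))) L); auto.
      + apply Series_correct, h2.
      + apply is_lim_seq_const. }
  rewrite <- e. exact hL.
Qed.

(** Reduction to nonnegative terms: [u = (|u| + u) - |u|]. *)
Lemma is_series_diag (u : nat -> nat -> R) :
  (forall l, ex_series (fun s => Rabs (u l s))) ->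
  ex_series (fun l => Series (fun s => Rabs (u l s))) ->
  is_series (fun n => sum_n (fun l => u l (n - l)%nat) n)
    (Series (fun l => Series (u l))).
Proof.
  intros h1 h2.
  assert (hu : forall l, ex_series (u l)) by (intros l; apply ex_series_Rabs, h1).
  set (v := fun l s => Rabs (u l s) + u l s).
  assert (hv0 : forall l s, 0 <= v l s).
  { intros l s. unfold v. pose proof (Rle_abs (- u l s)) as h.
    rewrite Rabs_Ropp in h. lra. }
  assert (hv1 : forall l, ex_series (v l)).
  { intros l. exact (ex_series_plus _ _ (h1 l) (hu l)). }
  assert (eu : forall l, Series (u l) = Series (v l) - Series (fun s => Rabs (u l s))).
  { intros l. unfold v. rewrite Series_plus by auto. ring. }
  assert (hu2 : ex_series (fun l => Series (u l))).
  { apply (ex_series_le (K := R_AbsRing) (V := R_CompleteNormedModule))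
      with (2 := h2). intros l. apply Series_Rabs, h1. }
  assert (hv2 : ex_series (fun l => Series (v l))).
  { apply ex_series_ext with
      (fun l => plus (Series (fun s => Rabs (u l s))) (Series (u l))).
    - intros l. rewrite eu. unfold plus; simpl. ring.
    - exact (ex_series_plus _ _ h2 hu2). }
  pose proof (is_series_diag_nonneg v hv0 hv1 hv2) as dv.
  pose proof (is_series_diag_nonneg (fun l s => Rabs (u l s))
    (fun l s => Rabs_pos _) h1 h2) as da.
  rewrite (Series_ext _ _ eu), Series_minus by assumption.
  refine (is_series_ext _ _ _ _ (is_series_minus _ _ _ _ dv da)).
  intros n. simpl. unfold v.
  change (fun l => Rabs (u l (n - l)%nat) + u l (n - l)%nat)
    with (fun l => plus (Rabs (u l (n - l)%nat)) (u l (n - l)%nat)).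
  rewrite sum_n_plus. unfold minus, plus, opp; simpl. ring.
Qed.

Lemma is_Cseries_diag (u : nat -> nat -> C) : abs_summable2 u ->
  is_Cseries (fun n => sum_n (G := C_NormedModule) (fun l => u l (n - l)%nat) n)
    (CSeries (fun l => CSeries (u l))).
Proof.
  intros [h1 h2]. apply is_Cseries_components.
  assert (key : forall f : C -> R, (forall c, Rabs (f c) <= Cmod c) ->
    is_series (fun n => sum_n (fun l => f (u l (n - l)%nat)) n)
      (Series (fun l => Series (fun s => f (u l s))))).
  { intros f hf.
    assert (hs : forall l, ex_series (fun s => Rabs (f (u l s)))).
    { intros l. apply ex_series_nonneg_le with (2 := h1 l).
      intros s. split; [apply Rabs_pos|apply hf]. }
    apply (is_series_diag (fun l s => f (u l s))).
    - exact hs.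
    - apply ex_series_nonneg_le with (2 := h2). intros l. split.
      + apply Series_nonneg; [intros; apply Rabs_pos|apply hs].
      + apply Series_le; [|apply h1]. intros s. split; [apply Rabs_pos|apply hf]. }
  split.
  - refine (is_series_ext _ _ _ _ (key Re re_le_Cmod)).
    intros n. now rewrite sum_n_C.
  - refine (is_series_ext _ _ _ _ (key Im Im_le_Cmod)).
    intros n. now rewrite sum_n_C.
Qed.

Lemma abs_summable2_le (u : nat -> nat -> C) (B : nat -> nat -> R) :
  (forall l s, Cmod (u l s) <= B l s) -> (forall l, ex_series (B l)) ->
  ex_series (fun l => Series (B l)) -> abs_summable2 u.
Proof.
  intros h h1 h2.
  assert (hs : forall l, ex_series (fun s => Cmod (u l s))).
  { intros l. apply ex_series_nonneg_le with (B l); [|apply h1].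
    intros s. split; [apply Cmod_ge_0|apply h]. }
  split; [exact hs|].
  apply ex_series_nonneg_le with (2 := h2). intros l. split.
  - apply Series_nonneg; [intros; apply Cmod_ge_0|apply hs].
  - apply Series_le; [|apply h1]. intros s. split; [apply Cmod_ge_0|apply h].
Qed.

(** Two applications of the diagonal rearrangement, first in [(s, m)] for each
    [l], then in [(l, s + m)].  The bound [B] is only asked for after the
    summation over [m], where a closed form is available. *)
Lemma is_Cseries_simplex (F : nat -> nat -> nat -> C) (B : nat -> nat -> R) :
  (forall l s, ex_series (fun m => Cmod (F l s m))) ->
  (forall l s, Series (fun m => Cmod (F l s m)) <= B l s) ->
  (forall l, ex_series (B l)) -> ex_series (fun l => Series (B l)) ->
  is_Cseries
    (fun k => sum_n (G := C_NormedModule) (fun l =>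
       sum_n (G := C_NormedModule) (fun s => F l s (k - l - s)%nat) (k - l)) k)
    (CSeries (fun l => CSeries (fun s => CSeries (F l s)))).
Proof.
  intros h1 hB h2 h3.
  assert (h0 : forall l s, 0 <= Series (fun m => Cmod (F l s m))).
  { intros l s. apply Series_nonneg; [intros; apply Cmod_ge_0|apply h1]. }
  assert (h4 : forall l, ex_series (fun s => Series (fun m => Cmod (F l s m)))).
  { intros l. apply ex_series_nonneg_le with (B l); [|apply h2]. auto. }
  set (u := fun l j => sum_n (G := C_NormedModule) (fun s => F l s (j - s)%nat) j).
  set (U := fun l j => sum_n (fun s => Cmod (F l s (j - s)%nat)) j).
  assert (hU : forall l, is_series (U l) (Series (fun s => Series (fun m => Cmod (F l s m))))).
  { intros l. apply (is_series_diag_nonneg (fun s m => Cmod (F l s m))); auto.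
    intros; apply Cmod_ge_0. }
  assert (hu : abs_summable2 u).
  { apply abs_summable2_le with U.
    - intros l j. unfold u, U, sum_n.
      exact (norm_sum_n_m (K := C_AbsRing) (V := C_NormedModule)
        (fun s => F l s (j - s)%nat) 0 j).
    - intros l. eexists. apply hU.
    - apply ex_series_nonneg_le with (2 := h3). intros l.
      rewrite (is_series_unique _ _ (hU l)). split.
      + apply Series_nonneg; auto.
      + apply Series_le; auto. }
  rewrite (CSeries_ext _ (fun l => CSeries (u l))).
  - exact (is_Cseries_diag u hu).
  - intros l. symmetry. apply CSeries_unique.
    apply (is_Cseries_diag (F l)). split; [apply h1|apply h4].
Qed.

(** * The binomial series *)

Lemma is_lim_seq_inv_add_INR (c : R) : is_lim_seq (fun n => / (c + INR n)) 0.
Proof.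
  apply (is_lim_seq_inv (fun n => c + INR n) p_infty); [|discriminate].
  apply (is_lim_seq_plus _ _ c p_infty); [apply is_lim_seq_const|apply is_lim_seq_INR|reflexivity].
Qed.

(** Positivity of [a] keeps the terms nonzero, as the ratio test requires. *)
Lemma ex_series_binomial_pos (a r : R) : 0 < a -> Rabs r < 1 ->
  ex_series (fun m => Rabs (poch a m / INR (fact m) * r ^ m)).
Proof.
  intros ha hr.
  assert (hf : forall n, 0 < INR (fact n)) by (intros; apply lt_0_INR, lt_O_fact).
  assert (hp : forall n, 0 < poch a n) by (intros; apply poch_pos, ha).
  apply (CV_disk_DAlembert (fun m => poch a m / INR (fact m)) r 1).
  - intros n. apply Rgt_not_eq, Rdiv_lt_0_compat; auto.
  - apply is_lim_seq_ext with (fun n => 1 + (a - 1) * / INR (S n)).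
    + intros n. pose proof (pos_INR n).
      rewrite fact_simpl, mult_INR, S_INR. cbn [poch].
      replace (_ / _ / _) with ((a + INR n) / (INR n + 1)).
      * rewrite Rabs_pos_eq; [field; lra|].
        apply Rdiv_le_0_compat; lra.
      * specialize (hf n). specialize (hp n). field. lra.
    + replace (Finite 1) with (Finite (1 + (a - 1) * 0)) by (f_equal; ring).
      apply is_lim_seq_plus'; [apply is_lim_seq_const|].
      apply is_lim_seq_mult'; [apply is_lim_seq_const|].
      apply (is_lim_seq_incr_1 (fun n => / INR n)).
      apply (is_lim_seq_inv INR p_infty); [apply is_lim_seq_INR|discriminate].
  - right. rewrite Rinv_1. lra.
Qed.

Lemma ex_series_binomial_abs (a r : R) : 0 <= r < 1 ->
  ex_series (fun m => Rabs (poch a m) / INR (fact m) * r ^ m).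
Proof.
  intros hr.
  apply ex_series_nonneg_le with (2 := ex_series_binomial_pos (Rabs a + 1) r
    ltac:(pose proof (Rabs_pos a); lra) ltac:(rewrite Rabs_pos_eq; lra)).
  intros n. pose proof (pow_le r n ltac:(lra)).
  assert (hf : 0 < INR (fact n)) by (apply lt_0_INR, lt_O_fact).
  split.
  - apply Rmult_le_pos; [apply Rdiv_le_0_compat; [apply Rabs_pos|exact hf]|lra].
  - eapply Rle_trans; [|apply Rle_abs].
    apply Rmult_le_compat_r; [lra|]. apply Rmult_le_compat_r.
    + apply Rlt_le, Rinv_0_lt_compat, hf.
    + eapply Rle_trans; [apply poch_abs_le|]. apply poch_le.
      pose proof (Rabs_pos a). lra.
Qed.

(** Real part of the logarithmic derivative of the path [f + i g]. *)
Lemma is_derive_ln_Cmod (f g : R -> R) (t f' g' : R) :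
  0 < f t -> is_derive f t f' -> is_derive g t g' ->
  is_derive (fun s => ln (Cmod (f s, g s))) t
    ((f t * f' + g t * g') / (f t ^ 2 + g t ^ 2)).
Proof.
  intros h0 hf hg. unfold Cmod; simpl fst; simpl snd.
  assert (hq : 0 < f t ^ 2 + g t ^ 2) by (pose proof (pow2_ge_0 (g t)); nra).
  auto_derive.
  - repeat split; try (eexists; eassumption); try exact I; simpl in hq; try lra.
    apply sqrt_lt_R0. lra.
  - assert (df : Derive (fun x : R => f x) t = f') by (apply is_derive_unique, hf).
    assert (dg : Derive (fun x : R => g x) t = g') by (apply is_derive_unique, hg).
    rewrite df, dg.
    replace (f t * (f t * 1) + g t * (g t * 1)) with (f t ^ 2 + g t ^ 2) by ring.
    assert (hs : 0 < sqrt (f t ^ 2 + g t ^ 2)) by (apply sqrt_lt_R0; lra).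
    pose proof (sqrt_sqrt (f t ^ 2 + g t ^ 2) ltac:(lra)) as e.
    rewrite <- e at 3. field. lra.
Qed.

(** Imaginary part of the logarithmic derivative of the path [f + i g]. *)
Lemma is_derive_Carg (f g : R -> R) (t f' g' : R) :
  0 < f t -> is_derive f t f' -> is_derive g t g' ->
  is_derive (fun s => Carg (f s, g s)) t
    ((f t * g' - g t * f') / (f t ^ 2 + g t ^ 2)).
Proof.
  intros h0 hf hg. unfold Carg, Cmod; simpl.
  assert (hq : 0 < f t ^ 2 + g t ^ 2) by (pose proof (pow2_ge_0 (g t)); nra).
  assert (hs : 0 < sqrt (f t ^ 2 + g t ^ 2)) by (apply sqrt_lt_R0; lra).
  auto_derive.
  - repeat split; try (eexists; eassumption); try exact I; simpl in hq, hs; lra.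
  - assert (df : Derive (fun x : R => f x) t = f') by (apply is_derive_unique, hf).
    assert (dg : Derive (fun x : R => g x) t = g') by (apply is_derive_unique, hg).
    rewrite df, dg.
    replace (f t * (f t * 1) + g t * (g t * 1)) with (f t ^ 2 + g t ^ 2) by ring.
    pose proof (sqrt_sqrt (f t ^ 2 + g t ^ 2) ltac:(lra)) as e.
    set (r := sqrt (f t ^ 2 + g t ^ 2)) in *.
    assert (eg : g t ^ 2 = r * r - f t ^ 2) by lra.
    assert (h1 : 0 < r + f t) by lra.
    replace (f t ^ 2 + g t ^ 2) with (r * r).
    assert (ed : 1 + (g t / (r + f t)) ^ 2 = 2 * r / (r + f t)).
    { replace ((g t / (r + f t)) ^ 2) with (g t ^ 2 / (r + f t) ^ 2) by (field; lra).
      rewrite eg. field. lra. }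
    replace (1 + g t * / (r + f t) * (g t * / (r + f t) * 1)) with (2 * r / (r + f t))
      by (rewrite <- ed; field; lra).
    apply Rminus_diag_uniq. field_simplify; [|lra..].
    replace (2 * g' * r ^ 2 - 2 * g' * f t ^ 2 - 2 * g' * g t ^ 2)
      with (2 * g' * (r * r - (f t ^ 2 + g t ^ 2))) by ring.
    rewrite e. unfold Rdiv. ring.
Qed.

(** The recurrence holds for the real parts [u m] and the imaginary parts [v m]
    of [(a)_m w^m / m!], where [w = x + i y].  It turns into the real part of
    [phi' = w (a phi + t phi')] for [phi t] the sum of the series at [t w].
    The imaginary part is the same statement for [(v, u)] and [- y]. *)
Lemma PSeries_binomial_ode (a x y t : R) (u v : nat -> R) :
  (forall m, INR (S m) * u (S m) = (a + INR m) * (x * u m - y * v m)) ->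
  Rbar_lt (Rabs t) (CV_radius u) -> Rbar_lt (Rabs t) (CV_radius v) ->
  PSeries (PS_derive u) t =
    x * (a * PSeries u t + t * PSeries (PS_derive u) t)
    - y * (a * PSeries v t + t * PSeries (PS_derive v) t).
Proof.
  intros hrec hu hv.
  assert (hE : forall c, Rbar_lt (Rabs t) (CV_radius c) ->
    is_series (fun m => a * (c m * t ^ m) + INR m * c m * t ^ m)
      (a * PSeries c t + t * PSeries (PS_derive c) t)).
  { intros c hc.
    assert (h1 : is_series (fun m => c m * t ^ m) (PSeries c t)).
    { apply Series_correct. apply CV_radius_inside in hc.
      apply ex_pseries_R in hc. exact hc. }
    assert (h2 : is_series (fun m => INR m * c m * t ^ m) (t * PSeries (PS_derive c) t)).
    { rewrite <- PSeries_incr_1.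
      apply is_series_ext with (fun m => PS_incr_1 (PS_derive c) m * t ^ m).
      - intros [|m]; [simpl; unfold zero; simpl; ring|reflexivity].
      - apply Series_correct.
        apply -> ex_pseries_R. apply ex_pseries_incr_1.
        apply CV_radius_inside. rewrite CV_radius_derive. exact hc. }
    exact (is_series_plus _ _ _ _ (is_series_scal a _ _ h1) h2). }
  unfold PSeries at 1. apply is_series_unique.
  refine (is_series_ext _ _ _ _ (is_series_minus _ _ _ _
    (is_series_scal x _ _ (hE u hu)) (is_series_scal y _ _ (hE v hv)))).
  intros m. unfold PS_derive. rewrite hrec.
  unfold minus, plus, opp, scal; simpl. unfold mult; simpl. ring.
Qed.

(** Every [rho >= 0] with [|w| rho < 1] is at most the radius of convergence, and
    [rho = 2 / (1 + |w|)] also exceeds [1].  [f] stands for the real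
    or the imaginary part. *)
Lemma CV_radius_binomial (a : R) (w : C) (f : C -> R) (t : R) :
  (forall c, Rabs (f c) <= Cmod c) -> Cmod w < 1 -> Rabs t <= 1 ->
  Rbar_lt (Rabs t) (CV_radius (fun m => poch a m / INR (fact m) * f (w ^ m)%C)).
Proof.
  intros hf hw ht.
  pose proof (Cmod_ge_0 w) as hw0.
  set (rho := 2 / (1 + Cmod w)).
  assert (hrho : 1 < rho).
  { unfold rho. apply Rminus_lt_0. replace (_ - 1) with ((1 - Cmod w) / (1 + Cmod w)) by (field; lra).
    apply Rdiv_lt_0_compat; lra. }
  assert (hr : 0 <= Cmod w * rho < 1).
  { split; [apply Rmult_le_pos; lra|]. unfold rho. apply Rminus_lt_0.
    replace (_ - _) with ((1 - Cmod w) / (1 + Cmod w)) by (field; lra).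
    apply Rdiv_lt_0_compat; lra. }
  apply Rbar_lt_le_trans with (Finite rho); [simpl; lra|].
  apply (proj1 (Lub_Rbar_correct _)). unfold CV_disk.
  apply ex_series_nonneg_le with (2 := ex_series_binomial_abs a (Cmod w * rho) hr).
  intros n. split; [apply Rabs_pos|].
  assert (hp : 0 < rho ^ n) by (apply pow_lt; lra).
  unfold Rdiv. rewrite !Rabs_mult, Rabs_inv, Rpow_mult_distr, (Rabs_pos_eq (rho ^ n)) by lra.
  rewrite (Rabs_pos_eq (INR (fact n))) by apply pos_INR.
  rewrite <- (Rmult_assoc _ (Cmod w ^ n)).
  apply Rmult_le_compat_r; [lra|]. apply Rmult_le_compat_l.
  - apply Rmult_le_pos; [apply Rabs_pos|].
    apply Rlt_le, Rinv_0_lt_compat, lt_0_INR, lt_O_fact.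
  - rewrite <- Cmod_pow. apply hf.
Qed.

Lemma Cpower_neq_0 (c : C) (a : R) : Cpower c a <> 0.
Proof.
  unfold Cpower. intros e.
  apply (f_equal Cmod) in e. rewrite Cmod_mult, Cmod_0, Cmod_R in e.
  assert (e1 : Cmod (cos (a * Carg c), sin (a * Carg c)) = 1).
  { unfold Cmod; simpl fst; simpl snd. rewrite <- sqrt_1. f_equal.
    pose proof (sin2_cos2 (a * Carg c)) as h. unfold Rsqr in h. lra. }
  rewrite e1, Rabs_pos_eq in e by apply Rlt_le, exp_pos.
  pose proof (exp_pos (a * ln (Cmod c))) as h. unfold Rpower in e. lra.
Qed.

(** With [phi t] the sum of the series at [t w], the function
    [G t = phi t * (1 - t w)^a] has zero derivative for [0 <= t <= 1] and
    [G 0 = 1].  Everything is written in real and imaginary parts. *)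
Lemma is_Cseries_binomial (a : R) (w : C) : Cmod w < 1 ->
  is_Cseries (fun m => (RtoC (poch a m / INR (fact m)) * w ^ m)%C)
    (/ Cpower (1 - w) a)%C.
Proof.
  intros hw. destruct w as [x y].
  set (u := fun m => poch a m / INR (fact m) * Re ((x, y) ^ m)%C).
  set (v := fun m => poch a m / INR (fact m) * Im ((x, y) ^ m)%C).
  assert (hu : forall t, 0 <= t <= 1 -> Rbar_lt (Rabs t) (CV_radius u)).
  { intros t ht. apply CV_radius_binomial; [apply re_le_Cmod|exact hw|].
    rewrite Rabs_pos_eq; lra. }
  assert (hv : forall t, 0 <= t <= 1 -> Rbar_lt (Rabs t) (CV_radius v)).
  { intros t ht. apply CV_radius_binomial; [apply Im_le_Cmod|exact hw|].
    rewrite Rabs_pos_eq; lra. }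
  assert (hrec : forall m,
    INR (S m) * u (S m) = (a + INR m) * (x * u m - y * v m) /\
    INR (S m) * v (S m) = (a + INR m) * (x * v m - - y * u m)).
  { intros m. unfold u, v. rewrite Cpow_S.
    rewrite fact_simpl, mult_INR. cbn [poch].
    assert (h1 : 0 < INR (S m)) by (apply lt_0_INR; lia).
    assert (h2 : 0 < INR (fact m)) by (apply lt_0_INR, lt_O_fact).
    destruct ((x, y) ^ m)%C as [p q]. simpl Re. simpl Im.
    split; field; lra. }
  set (P := PSeries u). set (Q := PSeries v).
  set (L := fun t => ln (Cmod (1 - t * x, - (t * y)))).
  set (T := fun t => Carg (1 - t * x, - (t * y))).
  set (G := fun t => (exp (a * L t) * (P t * cos (a * T t) - Q t * sin (a * T t)),
                      exp (a * L t) * (P t * sin (a * T t) + Q t * cos (a * T t)))).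
  assert (hx : forall t, 0 <= t <= 1 -> 0 < 1 - t * x).
  { intros t ht. pose proof (re_le_Cmod (x, y)) as h.
    change (Re (x, y)) with x in h.
    pose proof (Rle_abs (t * x)) as h1. rewrite Rabs_mult, (Rabs_pos_eq t) in h1 by lra.
    pose proof (Rabs_pos x). nra. }
  assert (hG : forall t, 0 <= t <= 1 ->
    is_derive (fun s => fst (G s)) t 0 /\ is_derive (fun s => snd (G s)) t 0).
  { intros t ht. specialize (hx t ht).
    assert (d1 : is_derive (fun s : R => 1 - s * x) t (- x)) by (auto_derive; [exact I|ring]).
    assert (d2 : is_derive (fun s : R => - (s * y)) t (- y)) by (auto_derive; [exact I|ring]).
    pose proof (is_derive_ln_Cmod _ _ t _ _ hx d1 d2) as dL.
    change (is_derive L t ((((1 - t * x) * - x + - (t * y) * - y)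
      / ((1 - t * x) ^ 2 + (- (t * y)) ^ 2)))) in dL.
    pose proof (is_derive_Carg _ _ t _ _ hx d1 d2) as dT.
    change (is_derive T t ((((1 - t * x) * - y - - (t * y) * - x)
      / ((1 - t * x) ^ 2 + (- (t * y)) ^ 2)))) in dT.
    pose proof (is_derive_PSeries u t (hu t ht)) as dP. fold P in dP.
    pose proof (is_derive_PSeries v t (hv t ht)) as dQ. fold Q in dQ.
    pose proof (PSeries_binomial_ode a x y t u v (fun m => proj1 (hrec m))
      (hu t ht) (hv t ht)) as eP.
    pose proof (PSeries_binomial_ode a x (- y) t v u (fun m => proj2 (hrec m))
      (hv t ht) (hu t ht)) as eQ.
    fold P Q in eP, eQ.
    set (P1 := PSeries (PS_derive u) t) in *. set (Q1 := PSeries (PS_derive v) t) in *.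
    set (k := (1 - t * x) ^ 2 + (- (t * y)) ^ 2) in *.
    assert (hk : 0 < k) by (unfold k; pose proof (pow2_ge_0 (- (t * y))); nra).
    set (L1 := _ / k) in dL. set (T1 := _ / k) in dT.
    (* [phi' = - a (L' + i T') phi], where [L' + i T'] is the logarithmic
       derivative of [1 - t w]. *)
    assert (fP : P1 = - a * (L1 * P t - T1 * Q t)).
    { apply Rmult_eq_reg_l with k; [|lra].
      replace (k * P1) with ((1 - t * x) * ((1 - t * x) * P1 + t * y * Q1)
        - t * y * ((1 - t * x) * Q1 - t * y * P1)) by (unfold k; ring).
      replace ((1 - t * x) * P1 + t * y * Q1) with (a * (x * P t - y * Q t)) by lra.
      replace ((1 - t * x) * Q1 - t * y * P1) with (a * (y * P t + x * Q t)) by lra.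
      unfold L1, T1. field. lra. }
    assert (fQ : Q1 = - a * (L1 * Q t + T1 * P t)).
    { apply Rmult_eq_reg_l with k; [|lra].
      replace (k * Q1) with ((1 - t * x) * ((1 - t * x) * Q1 - t * y * P1)
        + t * y * ((1 - t * x) * P1 + t * y * Q1)) by (unfold k; ring).
      replace ((1 - t * x) * P1 + t * y * Q1) with (a * (x * P t - y * Q t)) by lra.
      replace ((1 - t * x) * Q1 - t * y * P1) with (a * (y * P t + x * Q t)) by lra.
      unfold L1, T1. field. lra. }
    assert (eL : Derive (fun s : R => L s) t = L1) by (apply is_derive_unique, dL).
    assert (eT : Derive (fun s : R => T s) t = T1) by (apply is_derive_unique, dT).
    assert (eP1 : Derive (fun s : R => P s) t = P1) by (apply is_derive_unique, dP).
    assert (eQ1 : Derive (fun s : R => Q s) t = Q1) by (apply is_derive_unique, dQ).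
    unfold G; simpl. clearbody P Q L T P1 Q1 L1 T1.
    split; auto_derive; first
      [ repeat apply conj; try exact I; eexists; eassumption
      | rewrite eL, eT, eP1, eQ1, fP, fQ; ring ]. }
  assert (h01 : fst (G 0) = fst (G 1) /\ snd (G 0) = snd (G 1)).
  { split.
    - apply (eq_is_derive (fun s => fst (G s)) 0 1); [|lra]. intros t ht. apply (hG t ht).
    - apply (eq_is_derive (fun s => snd (G s)) 0 1); [|lra]. intros t ht. apply (hG t ht). }
  assert (hG0 : G 0 = RtoC 1).
  { unfold G, L, T, P, Q. rewrite !PSeries_0.
    assert (e : Cmod (1 - 0 * x, - (0 * y)) = 1).
    { transitivity (sqrt 1); [unfold Cmod; f_equal; simpl; ring|exact sqrt_1]. }
    unfold Carg. rewrite e, ln_1. simpl.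
    replace (- (0 * y) / _) with 0 by (unfold Rdiv; ring).
    rewrite atan_0, !Rmult_0_r, exp_0, cos_0, sin_0.
    unfold u, v; simpl. apply injective_projections; simpl; field. }
  assert (hS : (Cpower (1 - (x, y)) a * (P 1, Q 1))%C = 1).
  { transitivity (G 1).
    - unfold G, L, T, Cpower, Rpower.
      replace (1 - (x, y))%C with (1 - 1 * x, - (1 * y))
        by (apply injective_projections; simpl; ring).
      apply injective_projections; simpl; ring.
    - rewrite <- hG0. destruct h01 as [e1 e2].
      apply injective_projections; symmetry; assumption. }
  assert (hl : (/ Cpower (1 - (x, y)) a)%C = (P 1, Q 1)).
  { pose proof (Cpower_neq_0 (1 - (x, y)) a) as hc.
    set (c := Cpower (1 - (x, y)) a) in *. clearbody c.
    transitivity (/ c * (c * (P 1, Q 1)))%C; [rewrite hS; ring|field; exact hc]. }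
  rewrite hl. apply is_Cseries_components.
  assert (hc : forall c, Rbar_lt (Rabs 1) (CV_radius c) -> is_series c (PSeries c 1)).
  { intros c hc. apply is_series_ext with (fun m => c m * 1 ^ m).
    - intros n. rewrite pow1. apply Rmult_1_r.
    - apply Series_correct. apply ex_pseries_R, CV_radius_inside, hc. }
  split.
  - refine (is_series_ext _ _ _ _ (hc u (hu 1 ltac:(lra)))).
    intros n. unfold u. destruct ((x, y) ^ n)%C. simpl. ring.
  - refine (is_series_ext _ _ _ _ (hc v (hv 1 ltac:(lra)))).
    intros n. unfold v. destruct ((x, y) ^ n)%C. simpl. ring.
Qed.

Lemma is_series_binomial (a r : R) : 0 <= r < 1 ->
  is_series (fun m => poch a m / INR (fact m) * r ^ m) (Rpower (1 - r) (- a)).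
Proof.
  intros hr.
  assert (hw : Cmod r < 1) by (rewrite Cmod_R, Rabs_pos_eq; lra).
  pose proof (is_Cseries_binomial a r hw) as h.
  assert (e : (/ Cpower (1 - r) a)%C = RtoC (Rpower (1 - r) (- a))).
  { unfold Cpower, Carg. rewrite <- RtoC_minus, Cmod_R, Rabs_pos_eq by lra.
    simpl Im. unfold Rdiv. rewrite Rmult_0_l, atan_0, !Rmult_0_r, cos_0, sin_0.
    change (1, 0) with (RtoC 1). rewrite Cmult_1_r, Rpower_Ropp, RtoC_inv; [reflexivity|].
    apply Rgt_not_eq, exp_pos. }
  rewrite e in h. apply is_Cseries_components in h. destruct h as [h _].
  refine (is_series_ext _ _ _ _ h).
  intros n. rewrite <- RtoC_pow, <- RtoC_mult. reflexivity.
Qed.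

Lemma Rpower_sub_INR (r a : R) (n : nat) : 0 < r ->
  Rpower r (- (a + INR n)) = Rpower r (- a) * (/ r) ^ n.
Proof.
  intros hr. rewrite Ropp_plus_distr, Rpower_plus. f_equal.
  rewrite Rpower_Ropp, Rpower_pow by exact hr. now rewrite pow_inv.
Qed.

(** The half-angle formula does return an argument of [c]: with
    [u = tan (Carg c / 2)] the double-angle formulas give [cos] and [sin] of
    [Carg c] as [(1 - u^2) / (1 + u^2)] and [2 u / (1 + u^2)]. *)
Lemma polar_form (c : C) : 0 < Re c ->
  c = (Cmod c * cos (Carg c), Cmod c * sin (Carg c)).
Proof.
  intros hc.
  assert (hm : 0 < Cmod c) by (apply Rlt_le_trans with (1 := hc);
    eapply Rle_trans; [apply Rle_abs|apply re_le_Cmod]).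
  unfold Carg. set (r := Cmod c) in *. set (u := Im c / (r + Re c)).
  assert (hr : r ^ 2 = Re c ^ 2 + Im c ^ 2) by apply Cmod2_alt.
  assert (hu0 : 0 < 1 + u ^ 2) by (pose proof (pow2_ge_0 u); lra).
  assert (hs0 : 0 < sqrt (1 + u ^ 2)) by (apply sqrt_lt_R0, hu0).
  assert (hs : sqrt (1 + u ^ 2) ^ 2 = 1 + u ^ 2) by (apply pow2_sqrt; lra).
  assert (hu : 1 + u ^ 2 = 2 * r / (r + Re c)).
  { unfold u. replace ((Im c / (r + Re c)) ^ 2) with (Im c ^ 2 / (r + Re c) ^ 2)
      by (field; lra).
    replace (Im c ^ 2) with (r ^ 2 - Re c ^ 2) by lra. field. lra. }
  rewrite cos_2a, sin_2a, cos_atan, sin_atan.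
  rewrite Rsqr_pow2. set (t := sqrt (1 + u ^ 2)) in *.
  replace (1 / t * (1 / t) - u / t * (u / t)) with ((2 - (1 + u ^ 2)) / t ^ 2)
    by (field; lra).
  replace (2 * (u / t) * (1 / t)) with (2 * u / t ^ 2) by (field; lra).
  rewrite hs, hu. apply injective_projections; unfold u; simpl fst; simpl snd;
    [change (fst c) with (Re c)|change (snd c) with (Im c)]; field; lra.
Qed.

(** Only the exponents [a + n] are needed, so the functional equation reduces
    to [c^(x + 1) = c * c^x], which is the polar form of [c]. *)
Lemma Cpower_add_nat (c : C) (a : R) (n : nat) : 0 < Re c ->
  Cpower c (a + INR n) = (Cpower c a * c ^ n)%C.
Proof.
  intros hc.
  assert (hm : 0 < Cmod c) by (apply Rlt_le_trans with (1 := hc);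
    eapply Rle_trans; [apply Rle_abs|apply re_le_Cmod]).
  pose proof (polar_form c hc) as h1.
  induction n as [|n IH].
  - simpl. rewrite Rplus_0_r, Cmult_1_r. reflexivity.
  - rewrite S_INR, <- Rplus_assoc, Cpow_S.
    replace (Cpower c a * (c * c ^ n))%C with (c * (Cpower c a * c ^ n))%C by ring.
    rewrite <- IH. rewrite h1 at 2.
    unfold Cpower. rewrite Rpower_plus, Rpower_1 by exact hm.
    rewrite (Rmult_plus_distr_r (a + INR n)), Rmult_1_l, cos_plus, sin_plus.
    apply injective_projections; simpl; ring.
Qed.

(** * Domination of the double series *)

(** [(c)_n] outgrows every geometric sequence, because the series of
    [M^n / (c)_n] converges by the ratio test. *)
Lemma pow_le_poch (c M : R) : (forall n : nat, c <> - INR n) -> 0 <= M ->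
  exists K : R, 0 < K /\ forall n, M ^ n <= K * Rabs (poch c n).
Proof.
  intros hc hM.
  assert (hp : forall n, poch c n <> 0) by (intros; apply poch_neq_0, hc).
  assert (hs : ex_series (fun n => Rabs (/ poch c n * M ^ n))).
  { apply (CV_disk_DAlembert (fun n => / poch c n) M 0).
    - intros n. apply Rinv_neq_0_compat, hp.
    - apply is_lim_seq_ext with (fun n => Rabs (/ (c + INR n))).
      + intros n. f_equal. cbn [poch]. specialize (hp n). specialize (hc n).
        field. split; [exact hp|lra].
      + replace (Finite 0) with (Rbar_abs (Finite 0)) by (simpl; now rewrite Rabs_R0).
        apply is_lim_seq_abs, is_lim_seq_inv_add_INR.
    - now left. }
  exists (Series (fun n => Rabs (/ poch c n * M ^ n)) + 1). split.
  { apply Rle_lt_0_plus_1, Series_nonneg; [intros; apply Rabs_pos|exact hs]. }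
  intros n. specialize (hp n).
  assert (hpn : 0 < Rabs (poch c n)) by (apply Rabs_pos_lt, hp).
  assert (ht : Rabs (/ poch c n * M ^ n) <= Series (fun n => Rabs (/ poch c n * M ^ n))).
  { eapply Rle_trans; [|apply (sum_n_le_Series _ n); [intros; apply Rabs_pos|exact hs]].
    destruct n as [|n]; [rewrite sum_O; lra|]. rewrite sum_Sn.
    pose proof (sum_n_nonneg (fun n => Rabs (/ poch c n * M ^ n)) n (fun _ => Rabs_pos _)).
    unfold plus; simpl. simpl in H. lra. }
  rewrite Rabs_mult, Rabs_inv, (Rabs_pos_eq (M ^ n)) in ht by (apply pow_le, hM).
  apply (Rmult_le_compat_r (Rabs (poch c n))) in ht; [|lra].
  replace (/ Rabs (poch c n) * M ^ n * Rabs (poch c n)) with (M ^ n) in ht by (field; lra).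
  lra.
Qed.

(** The terms of the double series for moduli; only [(c)_(vs)] can be negative
    once [a] and [b] are positive. *)
Definition SD_majorant (a b c : R) (v : nat) (X Z : R) (l s : nat) : R :=
  poch a (2 * l + s) / (poch b l * Rabs (poch c (v * s))) *
  (X ^ l / INR (fact l)) * (Z ^ s / INR (fact s)).

Lemma SD_majorant_nonneg (a b c : R) (v : nat) (X Z : R) (l s : nat) :
  0 < a -> 0 < b -> (forall n : nat, c <> - INR n) -> 0 <= X -> 0 <= Z ->
  0 <= SD_majorant a b c v X Z l s.
Proof.
  intros ha hb hc hX hZ. unfold SD_majorant.
  assert (hf : forall n, 0 < INR (fact n)) by (intros; apply lt_0_INR, lt_O_fact).
  repeat apply Rmult_le_pos; try (apply pow_le; assumption);
    try (apply Rlt_le, Rinv_0_lt_compat, hf).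
  - apply Rlt_le, poch_pos, ha.
  - apply Rlt_le, Rinv_0_lt_compat, Rmult_lt_0_compat; [apply poch_pos, hb|].
    apply Rabs_pos_lt, poch_neq_0, hc.
Qed.

(** This is how the power of [1 / (1 - r)] left by the binomial series in [m]
    is absorbed into the arguments. *)
Lemma SD_majorant_scale (a b c : R) (v : nat) (X Z mu : R) (l s : nat) :
  SD_majorant a b c v (X * mu ^ 2) (Z * mu) l s =
  SD_majorant a b c v X Z l s * mu ^ (2 * l + s).
Proof.
  unfold SD_majorant. rewrite !Rpow_mult_distr, <- pow_mult, pow_add.
  unfold Rdiv. ring.
Qed.

(** The gap between [X] and [1/4] leaves room for an [eta > 0] with
    [X / (1 - eta)^2 < 1/4], and [Z^s / (c)_(vs)] is at most a constant times
    [eta^s]. *)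
Lemma SD_majorant_summable (a b c : R) (v : nat) (X Z : R) :
  0 < a -> 0 < b -> (forall n : nat, c <> - INR n) -> (1 <= v)%nat ->
  0 <= X -> 4 * X < 1 -> 0 <= Z ->
  (forall l, ex_series (SD_majorant a b c v X Z l)) /\
  ex_series (fun l => Series (SD_majorant a b c v X Z l)).
Proof.
  intros ha hb hc hv hX hX4 hZ.
  assert (hf : forall n, 0 < INR (fact n)) by (intros; apply lt_0_INR, lt_O_fact).
  assert (hpb : forall n, 0 < poch b n) by (intros; apply poch_pos, hb).
  (* [(1 - eta)^2 >= 1 - 2 eta = 1/2 + 2 X > 4 X]. *)
  set (eta := (1 - 4 * X) / 4).
  assert (heta : 0 < eta < 1) by (unfold eta; lra).
  assert (hM : 0 <= Z / eta) by (apply Rdiv_le_0_compat; lra).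
  destruct (pow_le_poch c (1 + Z / eta) hc ltac:(lra)) as [K [hK0 hK]].
  assert (hpow : forall s, Z ^ s / Rabs (poch c (v * s)) <= K * eta ^ s).
  { intros s. assert (hp : 0 < Rabs (poch c (v * s))) by (apply Rabs_pos_lt, poch_neq_0, hc).
    apply Rle_div_l; [exact hp|].
    replace (Z ^ s) with (eta ^ s * (Z / eta) ^ s)
      by (rewrite <- Rpow_mult_distr; f_equal; field; lra).
    rewrite (Rmult_comm K), Rmult_assoc.
    apply Rmult_le_compat_l; [apply pow_le; lra|].
    eapply Rle_trans; [|apply hK].
    apply Rle_trans with ((1 + Z / eta) ^ s); [apply pow_incr; lra|].
    apply Rle_pow; [lra|nia]. }
  set (d := fun l => poch a (2 * l) / (poch b l * INR (fact l))).
  assert (hd : forall l, 0 < d l).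
  { intros l. apply Rdiv_lt_0_compat; [apply poch_pos, ha|].
    apply Rmult_lt_0_compat; auto. }
  set (U := fun l s => K * (d l * X ^ l) *
    (poch (a + INR (2 * l)) s / INR (fact s) * eta ^ s)).
  assert (hle : forall l s, 0 <= SD_majorant a b c v X Z l s <= U l s).
  { intros l s. split; [apply SD_majorant_nonneg; assumption|].
    assert (hp : 0 < Rabs (poch c (v * s))) by (apply Rabs_pos_lt, poch_neq_0, hc).
    pose proof (hf l). pose proof (hf s). pose proof (hpb l).
    assert (hq : 0 < poch (a + INR (2 * l)) s).
    { apply poch_pos. pose proof (pos_INR (2 * l)). lra. }
    unfold SD_majorant. rewrite poch_add.
    replace (_ * _ * _) with (d l * X ^ l * (poch (a + INR (2 * l)) s / INR (fact s))
      * (Z ^ s / Rabs (poch c (v * s)))) by (unfold d; field; lra).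
    replace (U l s) with (d l * X ^ l * (poch (a + INR (2 * l)) s / INR (fact s))
      * (K * eta ^ s)) by (unfold U; ring).
    assert (hdl := hd l).
    apply Rmult_le_compat_l; [|apply hpow].
    apply Rmult_le_pos; [apply Rmult_le_pos; [lra|apply pow_le; lra]|].
    apply Rlt_le, Rdiv_lt_0_compat; assumption. }
  assert (hU : forall l, is_series (U l)
    (K * Rpower (1 - eta) (- a) * (d l * (X / (1 - eta) ^ 2) ^ l))).
  { intros l.
    replace (_ * _) with (K * (d l * X ^ l) * Rpower (1 - eta) (- (a + INR (2 * l)))).
    - apply (is_series_scal (K := R_AbsRing) (V := R_NormedModule)
        (K * (d l * X ^ l)) _ _ (is_series_binomial (a + INR (2 * l)) eta ltac:(lra))).
    - rewrite Rpower_sub_INR, pow_mult by lra. unfold Rdiv.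
      rewrite Rpow_mult_distr, pow_inv. ring. }
  assert (hMs : forall l, ex_series (SD_majorant a b c v X Z l)).
  { intros l. apply ex_series_nonneg_le with (U l); [apply hle|eexists; apply hU]. }
  split; [exact hMs|].
  set (rho := X / (1 - eta) ^ 2) in *.
  assert (h1eta : 0 < (1 - eta) ^ 2) by (apply pow_lt; lra).
  assert (hrho : 0 <= rho < / 4).
  { split; [apply Rdiv_le_0_compat; lra|].
    apply Rlt_div_l; [lra|]. unfold eta in *. nra. }
  assert (hds : ex_series (fun l => Rabs (d l * rho ^ l))).
  { apply (CV_disk_DAlembert d rho 4).
    - intros n. apply Rgt_not_eq, hd.
    - apply is_lim_seq_ext with
        (fun n => (2 + (a - 2 * b) * / (b + INR n)) * (2 + (a - 1) * / (1 + INR n))).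
      + intros n. unfold d. replace (2 * S n)%nat with (S (S (2 * n))) by lia.
        rewrite fact_simpl, mult_INR. cbn [poch]. rewrite !S_INR, mult_INR.
        change (INR 2) with 2.
        pose proof (hf n). pose proof (hpb n). pose proof (pos_INR n).
        assert (hp : 0 < poch a (2 * n)) by (apply poch_pos, ha).
        replace (_ / _ / _) with
          ((a + 2 * INR n) * (a + (2 * INR n + 1)) / ((b + INR n) * (INR n + 1)))
          by (field; repeat split; lra).
        rewrite Rabs_pos_eq; [field; lra|].
        apply Rdiv_le_0_compat; [apply Rmult_le_pos|apply Rmult_lt_0_compat]; lra.
      + replace (Finite 4) with (Finite ((2 + (a - 2 * b) * 0) * (2 + (a - 1) * 0)))
          by (f_equal; ring).
        apply is_lim_seq_mult'; apply is_lim_seq_plus';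
          try apply is_lim_seq_const; apply is_lim_seq_mult';
          try apply is_lim_seq_const; apply is_lim_seq_inv_add_INR.
    - right. split; [lra|]. rewrite Rabs_pos_eq; lra. }
  apply ex_series_nonneg_le with
    (fun l => K * Rpower (1 - eta) (- a) * Rabs (d l * rho ^ l)).
  - intros l. split.
    + apply Series_nonneg; [apply hle|apply hMs].
    + rewrite Rabs_pos_eq.
      * rewrite <- (is_series_unique _ _ (hU l)).
        apply Series_le; [apply hle|eexists; apply hU].
      * apply Rmult_le_pos; [apply Rlt_le, hd|apply pow_le, hrho].
  - exact (ex_series_scal (K * Rpower (1 - eta) (- a)) _ hds).
Qed.

Lemma Cmod_SD_term_le (a A b c : R) (v : nat) (X Z : C) (X' Z' : R) (l s : nat) :
  Rabs a <= A -> 0 < b -> Cmod X <= X' -> Cmod Z <= Z' ->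
  Cmod (SD_term a b c v X Z l s) <= SD_majorant A b c v X' Z' l s.
Proof.
  intros ha hb hX hZ. unfold SD_term, SD_majorant.
  assert (hf : forall n, 0 < INR (fact n)) by (intros; apply lt_0_INR, lt_O_fact).
  assert (hf0 : forall n, RtoC (INR (fact n)) <> 0).
  { intros n h. apply RtoC_inj in h. specialize (hf n). lra. }
  assert (hpow : forall (W : C) (W' : R) n, Cmod W <= W' ->
    0 <= Cmod (W ^ n / RtoC (INR (fact n))) <= W' ^ n / INR (fact n)).
  { intros W W' n hW. split; [apply Cmod_ge_0|].
    rewrite Cmod_div, Cmod_pow, Cmod_R, (Rabs_pos_eq (INR _)) by (try apply pos_INR; auto).
    apply Rmult_le_compat_r; [apply Rlt_le, Rinv_0_lt_compat, hf|].
    apply pow_incr. split; [apply Cmod_ge_0|exact hW]. }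
  rewrite !Cmod_mult.
  destruct (hpow X X' l hX) as [hX0 hX1], (hpow Z Z' s hZ) as [hZ0 hZ1].
  apply Rmult_le_compat; [apply Rmult_le_pos; apply Cmod_ge_0|exact hZ0| |exact hZ1].
  apply Rmult_le_compat; [apply Cmod_ge_0|exact hX0| |exact hX1].
  rewrite Cmod_R. unfold Rdiv. rewrite Rabs_mult, Rabs_inv, Rabs_mult.
  rewrite (Rabs_pos_eq (poch b l)) by (apply Rlt_le, poch_pos, hb).
  apply Rmult_le_compat_r.
  - rewrite <- (Rabs_pos_eq (poch b l)) by (apply Rlt_le, poch_pos, hb).
    rewrite <- Rabs_mult, <- Rabs_inv. apply Rabs_pos.
  - eapply Rle_trans; [apply poch_abs_le|]. apply poch_le.
    split; [apply Rabs_pos|exact ha].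
Qed.

Lemma SD_term_scale (a b c : R) (v : nat) (X Z mu : C) (l s : nat) :
  SD_term a b c v (X * mu ^ 2) (Z * mu) l s =
  (SD_term a b c v X Z l s * mu ^ (2 * l + s))%C.
Proof.
  unfold SD_term. rewrite !Cpow_mult_l, <- Cpow_mult_r, Cpow_add_r.
  unfold Cdiv. ring.
Qed.

(** * The generating function *)

(** The term of the triple series.  By [SD_term_scale], the factor in front of
    the binomial term turns into the term of the double series at the arguments
    of the theorem when it is multiplied by [(1 - w)^-(2l + s)]. *)
Definition expanded_term (a b c : R) (v : nat) (y z w : C) (l s m : nat) : C :=
  (SD_term a b c v (w * y) (- (w * z ^ v)) l s *
   (RtoC (poch (a + INR (2 * l + s)) m / INR (fact m)) * w ^ m))%C.



(** The sign [(-1)^k] of the polynomial cancels that of the generating series;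
    [(-1)^(l + s)] comes from [(-k)_(l + s)]. *)
Lemma Konhauser_coefficient (a b c : R) (v k l s : nat) :
  0 < b -> (forall n : nat, c <> - INR n) -> (l + s <= k)%nat ->
  (-1) ^ k * poch a k / poch b k * ((-1) ^ k * Gamma (b + INR k)) *
    (poch (- INR k) (l + s) * poch (a + INR k) l) /
    (Gamma (b + INR l) * Gamma (c + INR (v * s)) * INR (fact l) * INR (fact s))
    / INR (fact k) =
  / Gamma c * (poch a (2 * l + s) / (poch b l * poch c (v * s))
     / INR (fact l) / INR (fact s)
     * (poch (a + INR (2 * l + s)) (k - l - s) / INR (fact (k - l - s))))
  * (-1) ^ (l + s).
Proof.
  intros hb hc hk.
  assert (hb' : forall n : nat, b <> - INR n) by (intros n; pose proof (pos_INR n); lra).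
  destruct (Gamma_is_lim c hc) as [gc _].
  destruct (Gamma_is_lim b hb') as [gb _].
  rewrite !Gamma_add_INR by assumption.
  assert (hf : forall n, INR (fact n) <> 0) by (intros; apply INR_fact_neq_0).
  replace (poch a (2 * l + s) / (poch b l * poch c (v * s)) / INR (fact l) / INR (fact s)
     * (poch (a + INR (2 * l + s)) (k - l - s) / INR (fact (k - l - s))))
    with (poch a (2 * l + s) * poch (a + INR (2 * l + s)) (k - l - s)
      / (poch b l * poch c (v * s) * INR (fact l) * INR (fact s) * INR (fact (k - l - s)))).
  2: { field. repeat split; auto; apply poch_neq_0; assumption. }
  rewrite <- poch_add.
  replace (2 * l + s + (k - l - s))%nat with (k + l)%nat by lia.
  rewrite (poch_add a k l).
  assert (e : poch (- INR k) (l + s) =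
    (-1) ^ (l + s) * INR (fact k) / INR (fact (k - l - s))).
  { rewrite <- (poch_opp_INR k (l + s) hk), Nat.sub_add_distr. field. auto. }
  assert (e1 : (-1) ^ k * (-1) ^ k = 1).
  { rewrite <- pow_add. replace (k + k)%nat with (2 * k)%nat by lia. apply pow_1_even. }
  rewrite e.
  set (sg := (-1) ^ k) in *.
  replace (sg * poch a k / poch b k * (sg * (poch b k * Gamma b)))
    with (sg * sg * (poch a k * Gamma b)) by (field; apply poch_neq_0; assumption).
  rewrite e1. field.
  repeat split; auto; apply poch_neq_0; assumption.
Qed.

Lemma Konhauser_generating_term (p q : R) (k v : nat) (y z w : C) :
  -1 < q -> (forall n : nat, 1 - p - q <> - INR n) ->
  (RtoC ((-1) ^ k * poch (1 - p) k / poch (q + 1) k) *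
    MKonhauser p q k v y z * (w ^ k / RtoC (INR (fact k))))%C =
  (/ RtoC (Gamma (1 - p - q)) *
   sum_n (G := C_NormedModule) (fun l =>
     sum_n (G := C_NormedModule) (fun s =>
       expanded_term (1 - p) (q + 1) (1 - p - q) v y z w l s (k - l - s)) (k - l)) k)%C.
Proof.
  intros hq hc. unfold MKonhauser.
  set (a := 1 - p) in *. set (b := q + 1) in *. set (c := a - q) in *.
  assert (hb : 0 < b) by (unfold b; lra).
  assert (hb' : forall n : nat, b <> - INR n) by (intros n; pose proof (pos_INR n); lra).
  destruct (Gamma_is_lim c hc) as [gc _].
  destruct (Gamma_is_lim b hb') as [gb _].
  match goal with |- (?A * (?B * ?S) * ?D)%C = _ =>
    transitivity ((A * B * D) * S)%C; [ring|] end.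
  etransitivity; [apply sum_n_Cmult_l|]. rewrite sum_n_Cmult_l.
  apply sum_n_ext_loc. intros l hl.
  etransitivity; [apply sum_n_Cmult_l|]. rewrite sum_n_Cmult_l.
  apply sum_n_ext_loc. intros s hs.
  replace (INR k + q + 1) with (b + INR k) by (unfold b; ring).
  replace (INR k + 1 - p) with (a + INR k) by (unfold a; ring).
  replace (INR l + q + 1) with (b + INR l) by (unfold b; ring).
  replace (INR (v * s) - p - q + 1) with (c + INR (v * s)) by (unfold c, a; ring).
  assert (hden : Gamma (b + INR l) * Gamma (c + INR (v * s)) * INR (fact l) * INR (fact s) <> 0).
  { rewrite !Gamma_add_INR by assumption.
    repeat apply Rmult_integral_contrapositive_currified; auto using INR_fact_neq_0;
      apply poch_neq_0; assumption. }
  pose proof (Konhauser_coefficient a b c v k l s hb hc ltac:(lia)) as e.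
  apply (f_equal RtoC) in e.
  set (den := Gamma (b + INR l) * _ * _ * _) in *.
  assert (hf : forall n, INR (fact n) <> 0) by (intros; apply INR_fact_neq_0).
  set (num1 := (-1) ^ k * poch a k / poch b k) in *.
  set (num2 := (-1) ^ k * Gamma (b + INR k)) in *.
  set (num3 := poch (- INR k) (l + s) * poch (a + INR k) l) in *.
  match goal with |- ?x = ?y => change (@eq C x y) end.
  transitivity (RtoC (num1 * num2 * num3 / den / INR (fact k)) *
    ((- y) ^ l * z ^ (v * s) * w ^ k))%C.
  - rewrite !RtoC_div, !RtoC_mult by auto. unfold Cdiv. ring.
  - rewrite e. clearbody num1 num2 num3 den. unfold expanded_term, SD_term.
    rewrite !RtoC_mult, RtoC_inv by exact gc.
    set (r1 := poch a (2 * l + s) / _). set (r2 := poch _ _ / INR (fact (k - l - s))).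
    rewrite !RtoC_div by auto.
    assert (e1 : (RtoC ((-1) ^ (l + s)) * ((- y) ^ l * z ^ (v * s) * w ^ k))%C =
      ((w * y) ^ l * (- (w * z ^ v)) ^ s * w ^ (k - l - s))%C).
    { replace (w ^ k)%C with (w ^ l * (w ^ s * w ^ (k - l - s)))%C
        by (rewrite <- !Cpow_add_r; f_equal; lia).
      rewrite RtoC_pow, Cpow_add_r, Cpow_mult_r.
      replace ((w * y) ^ l)%C with (RtoC (-1) ^ l * (w ^ l * (- y) ^ l))%C
        by (rewrite <- !Cpow_mult_l; f_equal; ring).
      replace ((- (w * z ^ v)) ^ s)%C with (RtoC (-1) ^ s * (w ^ s * (z ^ v) ^ s))%C
        by (rewrite <- !Cpow_mult_l; f_equal; ring).
      ring. }
    rewrite <- Cmult_assoc, e1. unfold Cdiv. ring.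
Qed.

Theorem theorem14 (p q : R) (N v : nat) (y z w : C)
  (hp : 2 * INR N + 1 < p) (hq : -1 < q) (hv : (1 <= v)%nat)
  (hpq : forall n : nat, 1 - p - q <> - INR n)
  (hw : Cmod w < 1)
  (hwy : 4 * Cmod (w * y)%C < (1 - Cmod w) ^ 2) :
  let X := (w * y / (w - 1) ^ 2)%C in
  let Z := (w * z ^ v / (w - 1))%C in
  abs_summable2 (SD_term (1 - p) (q + 1) (1 - p - q) v X Z) /\
  is_series (K := C_AbsRing) (V := C_NormedModule)
    (fun k : nat =>
       (RtoC ((-1) ^ k * poch (1 - p) k / poch (q + 1) k) *
        MKonhauser p q k v y z * (w ^ k / RtoC (INR (fact k))))%C)
    (1 / (RtoC (Gamma (1 - p - q)) * Cpower (1 - w) (1 - p)) *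
     SD (1 - p) (q + 1) (1 - p - q) v X Z)%C.
Proof.
  intros X Z.
  destruct (Gamma_is_lim _ hpq) as [gc _].
  set (a := 1 - p) in *. set (b := q + 1) in *. set (c := a - q) in *.
  set (A := Rabs a).
  assert (hA : 0 < A).
  { apply Rabs_pos_lt. pose proof (pos_INR N). unfold a. lra. }
  assert (hb : 0 < b) by (unfold b; lra).
  set (r := Cmod w) in *.
  assert (hr : 0 <= r) by apply Cmod_ge_0.
  assert (hre : 0 < Re (1 - w)).
  { pose proof (re_le_Cmod w) as h. pose proof (Rle_abs (Re w)). fold r in h.
    unfold Cminus, Re in *. simpl. lra. }
  assert (hw1 : (1 - w)%C <> 0).
  { intros h. rewrite h in hre. simpl in hre. lra. }
  set (mu := (/ (1 - w))%C).
  assert (hmu : Cmod mu <= / (1 - r)).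
  { unfold mu. rewrite Cmod_inv by exact hw1. apply Rinv_le_contravar; [lra|].
    eapply Rle_trans; [|apply re_le_Cmod]. eapply Rle_trans; [|apply Rle_abs].
    pose proof (re_le_Cmod w) as h. pose proof (Rle_abs (Re w)). fold r in h.
    unfold Cminus, Re in *. simpl. lra. }
  set (X0 := (w * y)%C) in *. set (Z0 := (- (w * z ^ v))%C).
  assert (hX : X = (X0 * mu ^ 2)%C).
  { unfold X, mu. rewrite Cpow_inv by exact hw1.
    replace ((w - 1) ^ 2)%C with ((1 - w) ^ 2)%C by ring. reflexivity. }
  assert (hZ : Z = (Z0 * mu)%C).
  { unfold Z, Z0, mu. replace (w - 1)%C with (- (1 - w))%C by ring. field. exact hw1.
   }
  set (nu := / (1 - r)) in *.
  assert (hnu : 0 < nu) by (apply Rinv_0_lt_compat; lra).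
  destruct (SD_majorant_summable A b c v (Cmod X0 * nu ^ 2) (Cmod Z0 * nu)
    hA hb hpq hv) as [hM1 hM2].
  { apply Rmult_le_pos; [apply Cmod_ge_0|apply pow_le; lra]. }
  { unfold nu. rewrite pow_inv, <- Rmult_assoc. apply Rlt_div_l; [apply pow_lt; lra|].
    lra. }
  { apply Rmult_le_pos; [apply Cmod_ge_0|lra]. }
  assert (haA : Rabs a <= A) by apply Rle_refl.
  assert (hSD : abs_summable2 (SD_term a b c v X Z)).
  { apply abs_summable2_le with (2 := hM1) (3 := hM2). intros l s.
    apply Cmod_SD_term_le; [exact haA|exact hb| |].
    - rewrite hX, Cmod_mult, Cmod_pow. apply Rmult_le_compat_l; [apply Cmod_ge_0|].
      apply pow_incr. split; [apply Cmod_ge_0|exact hmu].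
    - rewrite hZ, Cmod_mult. apply Rmult_le_compat_l; [apply Cmod_ge_0|exact hmu]. }
  split; [exact hSD|].
  (* [D] dominates the triple series and [B] is its sum over [m]. *)
  set (F := expanded_term a b c v y z w).
  set (B := fun l s => Rpower (1 - r) (- A) *
    SD_majorant A b c v (Cmod X0 * nu ^ 2) (Cmod Z0 * nu) l s).
  set (D := fun l s m => SD_majorant A b c v (Cmod X0) (Cmod Z0) l s *
    (poch (A + INR (2 * l + s)) m / INR (fact m) * r ^ m)).
  assert (hDs : forall l s, is_series (D l s) (B l s)).
  { intros l s.
    replace (B l s) with (SD_majorant A b c v (Cmod X0) (Cmod Z0) l s *
      Rpower (1 - r) (- (A + INR (2 * l + s)))).
    - exact (is_series_scal (K := R_AbsRing) (V := R_NormedModule) _ _ _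
        (is_series_binomial (A + INR (2 * l + s)) r ltac:(lra))).
    - unfold B. rewrite SD_majorant_scale, Rpower_sub_INR by lra. fold nu. ring. }
  assert (hFD : forall l s m, 0 <= Cmod (F l s m) <= D l s m).
  { intros l s m. split; [apply Cmod_ge_0|]. unfold F, D, expanded_term.
    rewrite !Cmod_mult, Cmod_R, Cmod_pow. fold r.
    assert (hf : 0 < INR (fact m)) by (apply lt_0_INR, lt_O_fact).
    apply Rmult_le_compat; [apply Cmod_ge_0| | |].
    - apply Rmult_le_pos; [apply Rabs_pos|apply pow_le, hr].
    - apply Cmod_SD_term_le; [exact haA|exact hb|apply Rle_refl|apply Rle_refl].
    - apply Rmult_le_compat_r; [apply pow_le, hr|].
      unfold Rdiv. rewrite Rabs_mult, Rabs_inv, (Rabs_pos_eq (INR (fact m))) by lra.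
      apply Rmult_le_compat_r; [apply Rlt_le, Rinv_0_lt_compat, hf|].
      eapply Rle_trans; [apply poch_abs_le|]. apply poch_le.
      split; [apply Rabs_pos|]. eapply Rle_trans; [apply Rabs_triang|].
      rewrite (Rabs_pos_eq (INR (2 * l + s))) by apply pos_INR. lra. }
  assert (hFs : forall l s, ex_series (fun m => Cmod (F l s m))).
  { intros l s. apply ex_series_nonneg_le with (D l s); [apply hFD|eexists; apply hDs]. }
  assert (hFB : forall l s, Series (fun m => Cmod (F l s m)) <= B l s).
  { intros l s. rewrite <- (is_series_unique _ _ (hDs l s)).
    apply Series_le; [apply hFD|eexists; apply hDs]. }
  assert (hB1 : forall l, ex_series (B l)).
  { intros l. exact (ex_series_scal (Rpower (1 - r) (- A)) _ (hM1 l)). }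
  assert (hB2 : ex_series (fun l => Series (B l))).
  { apply ex_series_ext with (fun l => Rpower (1 - r) (- A) *
      Series (SD_majorant A b c v (Cmod X0 * nu ^ 2) (Cmod Z0 * nu) l)).
    - intros l. symmetry. apply Series_scal_l.
    - exact (ex_series_scal (Rpower (1 - r) (- A)) _ hM2). }
  pose proof (is_Cseries_simplex F B hFs hFB hB1 hB2) as hsum.
  assert (hFm : forall l s, CSeries (F l s) =
    (/ Cpower (1 - w) a * SD_term a b c v X Z l s)%C).
  { intros l s. apply CSeries_unique.
    replace (/ Cpower (1 - w) a * SD_term a b c v X Z l s)%C
      with (SD_term a b c v X0 Z0 l s * / Cpower (1 - w) (a + INR (2 * l + s)))%C.
    - exact (is_series_scal (K := C_AbsRing) (V := C_NormedModule) _ _ _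
        (is_Cseries_binomial (a + INR (2 * l + s)) w hw)).
    - rewrite hX, hZ, SD_term_scale, Cpower_add_nat by exact hre.
      unfold mu. rewrite Cpow_inv by exact hw1. field.
      split; [apply Cpow_nz, hw1|apply Cpower_neq_0]. }
  destruct hSD as [hSD1 hSD2].
  assert (hval : CSeries (fun l => CSeries (fun s => CSeries (F l s))) =
    (/ Cpower (1 - w) a * SD a b c v X Z)%C).
  { unfold SD. rewrite <- CSeries_scal_l.
    - apply CSeries_ext. intros l. rewrite <- CSeries_scal_l by apply hSD1.
      apply CSeries_ext. intros s. apply hFm.
    - apply ex_series_nonneg_le with (2 := hSD2). intros l.
      split; [apply Cmod_ge_0|]. apply Cmod_CSeries_le, hSD1. }
  rewrite hval in hsum.
  apply (is_series_scal (K := C_AbsRing) (V := C_NormedModule) (/ RtoC (Gamma c))%C) in hsum.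
  replace (1 / (RtoC (Gamma c) * Cpower (1 - w) a) * SD a b c v X Z)%C
    with (/ RtoC (Gamma c) * (/ Cpower (1 - w) a * SD a b c v X Z))%C
    by (field; split; [apply Cpower_neq_0|apply RtoC_neq_0, gc]).
  refine (is_series_ext _ _ _ _ hsum). intros k. symmetry.
  apply Konhauser_generating_term; assumption.
Qed.
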